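(* Let $K$ be a field and $L=L_K(R_2)$. There is an injective group homomorphism $$\Phi:\mathrm{GL}_\infty(K)=\varinjlim_n \mathrm{GL}_n(K)\longrightarrow L^\times,$$ where the transition maps are $M\mapsto\operatorname{diag}(M,1)$. Moreover, $\Phi$ is such that $\Phi(\mathrm{GL}_\infty(K))\subseteq \mathrm{LM}_2(K)$.
   Context: $L=L_K(R_2)$ is the unital associative $K$-algebra generated by $e,f,e^*,f^*$ subject to $e^*e=f^*f=1$, $e^*f=f^*e=0$, $ee^*+ff^*=1$. A word $\alpha=x_1\cdots x_r$ in the free monoid $\{e,f\}^*$ (with empty word $1$) is viewed as an element of $L$, and $\alpha^*=x_r^*\cdots x_1^*$, $1^*=1$. The rooted binary tree has vertex set $\{e,f\}^*$, root $1$, and $\gamma$ has children $\gamma e,\gamma f$. A finite rooted subtree is full if it contains the root, is closed under prefixes, and each of its vertices has either both children or no child in it. A leaf set is the set of leaves of such a finite full subtree; equivalently, it is obtained from $\{1\}$ by finitely many simple expansions, each replacing an element $\gamma$ by $\gamma e,\gamma f$. An ordered leaf set is an ordering of a leaf set. For ordered leaf sets $A=(\alpha_1,\ldots,\alpha_n)$, $B=(\beta_1,\ldots,\beta_n)$ and $M=(m_{ij})\in\mathrm{GL}_n(K)$, put $u(A,M,B)=\sum_{i,j=1}^n m_{ij}\alpha_i\beta_j^*$, a unit of $L$. $\mathrm{LM}_2(K)\subseteq L^\times$ is the set of all units of the form $u(A,M,B)$ with $A,B$ ordered leaf sets of the same cardinality $n$ and $M\in\mathrm{GL}_n(K)$,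 for any $n\ge1$. *)

(* Defs.v *)
From HB Require Import structures.
From mathcomp Require Import all_boot all_order all_algebra finmap.
From mathcomp Require boolp.
From mathcomp.multinomials Require Import monalg.

Set Implicit Arguments.
Unset Strict Implicit.
Unset Printing Implicit Defensive.

Import GRing.Theory.
Local Open Scope ring_scope.
Local Open Scope quotient_scope.

(* The group of units R^* of a (possibly infinite, non-commutative) ring.     *)
Section UnitGroup.
Variable R : unitRingType.

Record unitGroup := UnitGroup { unit_val : R; _ : unit_val \is a GRing.unit }.

HB.instance Definition _ := [isSub for unit_val].
HB.instance Definition _ := [Choice of unitGroup by <:].

Implicit Types u v w : unitGroup.

Definition unit_one := UnitGroup (unitr1 R).
Definition unit_inv u : unitGroup :=
  UnitGroup (etrans (unitrV (val u)) (valP u)).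
Fact unit_mul_subproof u v : val u * val v \is a GRing.unit.
Proof. by rewrite unitrMr (valP u, valP v). Qed.
Definition unit_mul u v := UnitGroup (unit_mul_subproof u v).

Fact unit_mulA : associative unit_mul.
Proof. by move=> u v w; apply: val_inj; apply: mulrA. Qed.
Fact unit_mul1 : left_id unit_one unit_mul.
Proof. by move=> u; apply: val_inj; apply: mul1r. Qed.
Fact unit_1mul : right_id unit_one unit_mul.
Proof. by move=> u; apply: val_inj; apply: mulr1. Qed.
Fact unit_mulV : left_inverse unit_one unit_inv unit_mul.
Proof. by move=> u; apply: val_inj; apply: (mulVr (valP u)). Qed.
Fact unit_Vmul : right_inverse unit_one unit_inv unit_mul.
Proof. by move=> u; apply: val_inj; apply: (mulrV (valP u)). Qed.

HB.instance Definition _ := isGroup.Build unitGroup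
  unit_mulA unit_mul1 unit_1mul unit_mulV unit_Vmul.

Lemma val_unitGroupM u v : val (u * v)%g = val u * val v. Proof. by []. Qed.
Lemma val_unitGroup1 : val (1%g : unitGroup) = 1. Proof. by []. Qed.
End UnitGroup.

(* The direct limit of a sequence of groups G 0 -> G 1 -> G 2 -> ...          *)
Section DirectLimit.
Variables (G : nat -> groupType) (f : forall n, {multiplicative G n -> G n.+1}).

Fixpoint trans_iter n k : G n -> G (k + n) :=
  if k is k'.+1 then fun x => f _ (trans_iter k' x) else id.

Definition trans n p (le_np : (n <= p)%N) (x : G n) : G p :=
  ecast i (G i) (subnK le_np) (trans_iter (p - n) x).

Definition stage : choiceType := {n : nat & (G n : choiceType)}.
Definition stage_of n (x : G n) : stage := Tagged G x.

(* x in G n and y in G m are identified when they agree in some later G p.    *)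
Definition dirlim_rel (x y : stage) : bool :=
  boolp.asbool (exists p (lex : (tag x <= p)%N) (ley : (tag y <= p)%N),
    trans lex (tagged x) = trans ley (tagged y)).

Let S (x : stage) : stage := stage_of (f _ (tagged x)).

Lemma stage_of_inj n : injective (@stage_of n).
Proof. by move=> x y /eqP; rewrite eq_Tagged => /eqP. Qed.

Lemma stage_of_trans n p (le_np : (n <= p)%N) (x : G n) :
  stage_of (trans le_np x) = iter (p - n) S (stage_of x).
Proof.
rewrite /trans; have -> : forall m q (e : m = q) (z : G m),
  stage_of (ecast i (G i) e z) = stage_of z by move=> m q e; case: q / e.
by elim: (p - n)%N => //= k <-.
Qed.

Lemma trans_comp n p q (le_np : (n <= p)%N) (le_pq : (p <= q)%N)
    (le_nq : (n <= q)%N) x : trans le_pq (trans le_np x) = trans le_nq x.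
Proof.
apply: stage_of_inj; rewrite !stage_of_trans -iterD; congr (iter _ _ _).
by rewrite addnBA // subnK.
Qed.

Lemma trans_refl n (le_nn : (n <= n)%N) x : trans le_nn x = x.
Proof. by apply: stage_of_inj; rewrite stage_of_trans subnn. Qed.

Lemma trans_succ n (le_nn1 : (n <= n.+1)%N) x : trans le_nn1 x = f n x.
Proof. by apply: stage_of_inj; rewrite stage_of_trans subSnn. Qed.

Lemma transM n p (le_np : (n <= p)%N) :
  {morph trans le_np : x y / (x * y)%g >-> (x * y)%g}.
Proof.
move=> x y; rewrite /trans.
have -> : trans_iter (p - n) (x * y)%g
        = (trans_iter (p - n) x * trans_iter (p - n) y)%g.
  by elim: (p - n)%N => //= k ->; rewrite gmulfM.
have castM m q (e : m = q) (u v : G m) :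
    ecast i (G i) e (u * v)%g = (ecast i (G i) e u * ecast i (G i) e v)%g.
  by case: q / e.
exact: castM.
Qed.

Lemma trans1 n p (le_np : (n <= p)%N) : trans le_np 1%g = 1%g.
Proof. by apply: (@mulgI _ (trans le_np 1%g)); rewrite -transM !mulg1. Qed.

Lemma transV n p (le_np : (n <= p)%N) x : trans le_np x^-1%g = (trans le_np x)^-1%g.
Proof. by apply: (@mulgI _ (trans le_np x)); rewrite -transM !mulgV trans1. Qed.

Lemma dirlim_relP x y : reflect
  (exists p (lex : (tag x <= p)%N) (ley : (tag y <= p)%N),
    trans lex (tagged x) = trans ley (tagged y)) (dirlim_rel x y).
Proof. exact: boolp.asboolP. Qed.

Lemma dirlim_rel_equiv : equiv_class_of dirlim_rel.
Proof.
split=> [x|x y|y x z].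
- by apply/dirlim_relP; exists (tag x), (leqnn _), (leqnn _).
- by apply/dirlim_relP/dirlim_relP => -[p [lex [ley e]]]; exists p, ley, lex.
move=> /dirlim_relP[p [lexp [leyp e]]] /dirlim_relP[q [leyq [lezq e']]].
apply/dirlim_relP; have [lep leq] := (leq_maxl p q, leq_maxr p q).
exists (maxn p q), (leq_trans lexp lep), (leq_trans lezq leq).
rewrite -(trans_comp lexp lep) e (trans_comp _ _ (leq_trans leyp lep)).
by rewrite -(trans_comp lezq leq) -e' (trans_comp _ _ (leq_trans leyp lep)).
Qed.

Canonical dirlim_equiv := EquivRelPack dirlim_rel_equiv.
Canonical dirlim_encModRel := defaultEncModRel dirlim_rel.

Definition dirlim := {eq_quot dirlim_rel}.
HB.instance Definition _ : EqQuotient stage dirlim_rel dirlim :=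
  EqQuotient.on dirlim.
HB.instance Definition _ := Choice.on dirlim.

Definition to_dirlim n (x : G n) : dirlim := \pi_dirlim (stage_of x).

Lemma to_dirlim_eqP n m (x : G n) (y : G m) : to_dirlim x = to_dirlim y <->
  exists p (len : (n <= p)%N) (lem : (m <= p)%N), trans len x = trans lem y.
Proof.
by split=> [/eqquotP/dirlim_relP //|h]; apply/eqquotP/dirlim_relP.
Qed.

Lemma to_dirlim_trans n p (le_np : (n <= p)%N) x :
  to_dirlim (trans le_np x) = to_dirlim x.
Proof.
apply/to_dirlim_eqP; exists p, (leqnn p), le_np; exact: trans_comp.
Qed.

Lemma dirlimW (x : dirlim) : exists n (y : G n), x = to_dirlim y.
Proof.
by exists (tag (repr x)), (tagged (repr x)); rewrite /to_dirlim /stage_of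
  -[LHS]reprK; case: (repr x).
Qed.

Definition stage_mul (x y : stage) : stage :=
  stage_of (trans (leq_maxl (tag x) (tag y)) (tagged x)
          * trans (leq_maxr (tag x) (tag y)) (tagged y))%g.

Definition dirlim_one : dirlim := to_dirlim (1%g : G 0).
Definition dirlim_mul (x y : dirlim) : dirlim :=
  \pi_dirlim (stage_mul (repr x) (repr y)).
Definition dirlim_inv (x : dirlim) : dirlim :=
  to_dirlim (tagged (repr x))^-1%g.

Lemma repr_to_dirlim n (x : G n) : exists p (len : (n <= p)%N)
   (ler : (tag (repr (to_dirlim x)) <= p)%N),
   trans ler (tagged (repr (to_dirlim x))) = trans len x.
Proof.
have /to_dirlim_eqP[p [l1 [l2 e]]] :
    to_dirlim (tagged (repr (to_dirlim x))) = to_dirlim x.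
  by rewrite -[RHS]reprK /to_dirlim /stage_of; case: (repr _).
by exists p, l2, l1.
Qed.

Lemma to_dirlimM_in n (x y : G n) :
  dirlim_mul (to_dirlim x) (to_dirlim y) = to_dirlim (x * y)%g.
Proof.
have [p [lenp [lerp ep]]] := repr_to_dirlim x.
have [q [lenq [lerq eq]]] := repr_to_dirlim y.
rewrite /dirlim_mul /stage_mul -/(to_dirlim _).
move: (leq_maxl _ _) (leq_maxr _ _); set k := maxn _ _ => lk rk.
apply/to_dirlim_eqP.
have l1 : (k <= maxn p q)%N.
  by rewrite geq_max !leq_max lerp lerq orbT.
have [lp lq] := (leq_maxl p q, leq_maxr p q).
exists (maxn p q), l1, (leq_trans lenp lp); rewrite !transM.
rewrite (trans_comp lk l1 (leq_trans lerp lp)) -(trans_comp lerp lp) ep.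
rewrite (trans_comp rk l1 (leq_trans lerq lq)) -(trans_comp lerq lq) eq.
by rewrite !(trans_comp _ _ (leq_trans lenp lp)).
Qed.

Lemma dirlimW2 (x y : dirlim) :
  exists n (x' y' : G n), x = to_dirlim x' /\ y = to_dirlim y'.
Proof.
have [[n [x' ->]] [m [y' ->]]] := (dirlimW x, dirlimW y).
exists (maxn n m), (trans (leq_maxl _ _) x'), (trans (leq_maxr _ _) y').
by rewrite !to_dirlim_trans.
Qed.

Lemma dirlimW3 (x y z : dirlim) : exists n (x' y' z' : G n),
  [/\ x = to_dirlim x', y = to_dirlim y' & z = to_dirlim z'].
Proof.
have [[n [x' [y' [-> ->]]]] [m [z' ->]]] := (dirlimW2 x y, dirlimW z).
exists (maxn n m), (trans (leq_maxl _ _) x'), (trans (leq_maxl _ _) y'),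
  (trans (leq_maxr _ _) z').
by rewrite !to_dirlim_trans.
Qed.

Lemma to_dirlim1_in n : to_dirlim (1%g : G n) = dirlim_one.
Proof. by rewrite -(trans1 (leq0n n)) to_dirlim_trans. Qed.

Lemma to_dirlimV_in n (x : G n) : dirlim_inv (to_dirlim x) = to_dirlim x^-1%g.
Proof.
have [p [lenp [lerp ep]]] := repr_to_dirlim x.
by apply/to_dirlim_eqP; exists p, lerp, lenp; rewrite !transV ep.
Qed.

Fact dirlim_mulA : associative dirlim_mul.
Proof.
by move=> x y z; have [n [x' [y' [z' [-> -> ->]]]]] := dirlimW3 x y z;
  rewrite !to_dirlimM_in mulgA.
Qed.
Fact dirlim_mul1 : left_id dirlim_one dirlim_mul.
Proof.
by move=> x; have [n [y ->]] := dirlimW x;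
  rewrite -(to_dirlim1_in n) to_dirlimM_in mul1g.
Qed.
Fact dirlim_1mul : right_id dirlim_one dirlim_mul.
Proof.
by move=> x; have [n [y ->]] := dirlimW x;
  rewrite -(to_dirlim1_in n) to_dirlimM_in mulg1.
Qed.
Fact dirlim_mulV : left_inverse dirlim_one dirlim_inv dirlim_mul.
Proof.
by move=> x; have [n [y ->]] := dirlimW x;
  rewrite -(to_dirlim1_in n) to_dirlimV_in to_dirlimM_in mulVg.
Qed.
Fact dirlim_Vmul : right_inverse dirlim_one dirlim_inv dirlim_mul.
Proof.
by move=> x; have [n [y ->]] := dirlimW x;
  rewrite -(to_dirlim1_in n) to_dirlimV_in to_dirlimM_in mulgV.
Qed.

HB.instance Definition _ := isGroup.Build dirlim
  dirlim_mulA dirlim_mul1 dirlim_1mul dirlim_mulV dirlim_Vmul.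

Lemma to_dirlimM n : {morph @to_dirlim n : x y / (x * y)%g >-> (x * y)%g}.
Proof. by move=> x y; rewrite -to_dirlimM_in. Qed.

Lemma to_dirlim_f n (x : G n) : to_dirlim (f n x) = to_dirlim x.
Proof. by rewrite -(trans_succ (leqnSn n)) to_dirlim_trans. Qed.
End DirectLimit.

(* GL_infinity(K); [GL K n] is GL_{n+1}(K), so that the sequence starts with  *)
(* GL_1(K).                                                                   *)
Section GLinf.
Variable K : fieldType.

Definition GL (n : nat) : groupType := unitGroup 'M[K]_n.+1.

Definition diag1 n (M : 'M[K]_n) : 'M[K]_n.+1 :=
  castmx (addn1 n, addn1 n) (block_mx M 0 0 (1%:M : 'M_1)).

Lemma diag1_unit n (M : 'M[K]_n) : (diag1 M \in unitmx) = (M \in unitmx).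
Proof.
have -> : forall m q (e : m = q) (A : 'M[K]_m),
  (castmx (e, e) A \in unitmx) = (A \in unitmx) by move=> m q e; case: q / e.
by rewrite !unitmxE det_ublock det1 mulr1.
Qed.

Lemma diag1M n : {morph @diag1 n : M N / M *m N}.
Proof.
have castM m q (e : m = q) (A B : 'M[K]_m) :
  castmx (e, e) (A *m B) = castmx (e, e) A *m castmx (e, e) B.
  by case: q / e.
move=> M N; rewrite /diag1 -castM mulmx_block.
by rewrite !(mulmx0, mul0mx, addr0, add0r, mulmx1).
Qed.

Fact GL_incl_subproof n (M : GL n) : diag1 (val M) \is a GRing.unit.
Proof. by move: (valP M); rewrite -[_ \is a _]diag1_unit. Qed.
Definition GL_incl n (M : GL n) : GL n.+1 := UnitGroup (GL_incl_subproof M).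

Fact GL_inclM n : {morph @GL_incl n : M N / (M * N)%g >-> (M * N)%g}.
Proof. by move=> M N; apply: val_inj; apply: diag1M. Qed.
HB.instance Definition _ n :=
  monoid.isMultiplicative.Build (GL n) (GL n.+1) (@GL_incl n) (@GL_inclM n).

Definition GLinf : groupType := @dirlim GL (fun n => @GL_incl n).
End GLinf.

Section TwoSidedIdeal.
Variables (R : nzRingType) (X : R -> Prop).

Inductive ideal_gen : R -> Prop :=
| IdealGen x of X x : ideal_gen x
| Ideal0 : ideal_gen 0
| IdealD x y of ideal_gen x & ideal_gen y : ideal_gen (x + y)
| IdealMl a x of ideal_gen x : ideal_gen (a * x)
| IdealMr a x of ideal_gen x : ideal_gen (x * a).

Definition ideal_pred : {pred R} := fun x => boolp.asbool (ideal_gen x).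

Lemma ideal_predP x : reflect (ideal_gen x) (x \in ideal_pred).
Proof. exact: boolp.asboolP. Qed.

Fact ideal_zmod_closed : zmod_closed ideal_pred.
Proof.
split=> [|x y /ideal_predP Ix /ideal_predP Iy]; apply/ideal_predP.
  exact: Ideal0.
by rewrite -mulN1r; apply: IdealD => //; apply: IdealMl.
Qed.
HB.instance Definition _ :=
  GRing.isZmodClosed.Build R ideal_pred ideal_zmod_closed.

Lemma ideal_Ml a x : x \in ideal_pred -> a * x \in ideal_pred.
Proof. by move=> /ideal_predP Ix; apply/ideal_predP/IdealMl. Qed.
Lemma ideal_Mr a x : x \in ideal_pred -> x * a \in ideal_pred.
Proof. by move=> /ideal_predP Ix; apply/ideal_predP/IdealMr. Qed.
End TwoSidedIdeal.

(* The letters e and f are encoded as false and true.                         *)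
Definition letter := bool.
Definition word := seq letter.

(* L_K(R_2): the free algebra on e, f, e^*, f^* (the monoid algebra of the    *)
(* free monoid on four letters) modulo the two-sided ideal of the relations.  *)
Section Leavitt.
Variable K : fieldType.

(* inl x is the generator x, and inr x is the generator x^*.                  *)
Definition free_alg := {malg K[{fmonom (letter + letter)%type}]}.
HB.instance Definition _ := GRing.Lalgebra.on free_alg.

Definition gen (i : letter + letter) : free_alg := << fmu i >>.

(* e_ and f_ stand for e^* and f^*.                                          *)
Local Notation e := (gen (inl false)).
Local Notation f := (gen (inl true)).
Local Notation e_ := (gen (inr false)).
Local Notation f_ := (gen (inr true)).

Inductive leavitt_rels : free_alg -> Prop :=
| Rel_ee : leavitt_rels (e_ * e - 1)
| Rel_ff : leavitt_rels (f_ * f - 1)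
| Rel_ef : leavitt_rels (e_ * f)
| Rel_fe : leavitt_rels (f_ * e)
| Rel_1  : leavitt_rels (e * e_ + f * f_ - 1).

Definition leavitt_ideal : {pred free_alg} := ideal_pred leavitt_rels.
HB.instance Definition _ := GRing.ZmodClosed.on leavitt_ideal.

Definition leavitt := Quotient.quot leavitt_ideal.
HB.instance Definition _ := GRing.Zmodule.on leavitt.

Local Notation pi := (\pi_leavitt).

Lemma leavitt_piP (x y : free_alg) :
  pi x = pi y <-> x - y \in leavitt_ideal.
Proof. by rewrite Quotient.idealrBE; split=> /eqP. Qed.

Lemma leavitt_piD x y : pi (x + y) = pi x + pi y.
Proof. exact: (@pi_addr _ _ _ _ _ (Quotient.quot leavitt_ideal)). Qed.

Lemma leavittW (x : leavitt) : exists y, x = pi y.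
Proof. by exists (repr x); rewrite reprK. Qed.

Definition leavitt_one : leavitt := pi 1.
Definition leavitt_mul (x y : leavitt) : leavitt := pi (repr x * repr y).
Definition leavitt_scale (c : K) (x : leavitt) : leavitt := pi (c *: repr x).

Lemma leavitt_piM x y : leavitt_mul (pi x) (pi y) = pi (x * y).
Proof.
have rE z : repr (pi z) - z \in leavitt_ideal by apply/leavitt_piP/reprK.
apply/leavitt_piP; set x' := repr _; set y' := repr _.
have -> : x' * y' - x * y = (x' - x) * y' + x * (y' - y).
  by rewrite mulrBl mulrBr addrA subrK.
by apply: rpredD; [apply: ideal_Mr | apply: ideal_Ml]; apply: rE.
Qed.

Lemma leavitt_piZ c x : leavitt_scale c (pi x) = pi (c *: x).
Proof.
apply/leavitt_piP; rewrite -scalerBr -mulr_algl; apply: ideal_Ml.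
by apply/leavitt_piP/reprK.
Qed.

Lemma free_alg_scalerAr (c : K) (x y : free_alg) : c *: (x * y) = x * (c *: y).
Proof.
have Cc : x * malgC c = malgC c * x.
  rewrite [LHS]fgmulgU [RHS]fgmulUg; apply: eq_bigr => m _.
  by rewrite mulrC mulm1 mul1m.
rewrite -!mul_malgC !mulrA Cc; exact: erefl.
Qed.

Fact leavitt_mulA : associative leavitt_mul.
Proof.
move=> x y z; have [[x' ->] [[y' ->] [z' ->]]] :=
  (leavittW x, (leavittW y, leavittW z)).
by rewrite !leavitt_piM mulrA.
Qed.
Fact leavitt_mul1 : left_id leavitt_one leavitt_mul.
Proof. by move=> x; have [y ->] := leavittW x; rewrite leavitt_piM mul1r. Qed.
Fact leavitt_1mul : right_id leavitt_one leavitt_mul.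
Proof. by move=> x; have [y ->] := leavittW x; rewrite leavitt_piM mulr1. Qed.
Fact leavitt_mulDl : left_distributive leavitt_mul +%R.
Proof.
move=> x y z; have [[x' ->] [[y' ->] [z' ->]]] :=
  (leavittW x, (leavittW y, leavittW z)).
by rewrite -leavitt_piD !leavitt_piM mulrDl leavitt_piD.
Qed.
Fact leavitt_mulDr : right_distributive leavitt_mul +%R.
Proof.
move=> x y z; have [[x' ->] [[y' ->] [z' ->]]] :=
  (leavittW x, (leavittW y, leavittW z)).
by rewrite -leavitt_piD !leavitt_piM mulrDr leavitt_piD.
Qed.

(* L is nonzero, because it acts on the space of sequences nat -> K by        *)
(* (e v)_(2n) = v_n, (e v)_(2n+1) = 0, (f v)_(2n) = 0, (f v)_(2n+1) = v_n,    *)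
(* (e^* v)_n = v_(2n) and (f^* v)_n = v_(2n+1).                               *)
Definition act_gen (i : letter + letter) (v : nat -> K) : nat -> K :=
  match i with
  | inl b => fun n => if odd n == b then v n./2 else 0
  | inr b => fun n => v (b + n.*2)%N
  end.

Definition act_word (w : seq (letter + letter)) (v : nat -> K) : nat -> K :=
  foldr act_gen v w.

Definition act (p : free_alg) (v : nat -> K) (n : nat) : K :=
  \sum_(m <- msupp p) p@_m * act_word m v n.

Lemma act_word_sum (I : Type) (r : seq I) (c : I -> K) (v : I -> nat -> K) w n :
  act_word w (fun k => \sum_(i <- r) c i * v i k) n =
  \sum_(i <- r) c i * act_word w (v i) n.
Proof.
elim: w n => //= -[] b w IHw n /=; last by rewrite IHw.
by case: ifP => _; rewrite ?IHw // big1 // => i _; rewrite mulr0.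
Qed.

Lemma act_w (E : {fset {fmonom (letter + letter)%type}}) (p : free_alg) v n :
  fsubset (msupp p) E -> act p v n = \sum_(m <- E) p@_m * act_word m v n.
Proof.
move=> sE; apply: big_fset_incl => // m _ /mcoeff_outdom ->.
by rewrite mul0r.
Qed.

Lemma actD p q v n : act (p + q) v n = act p v n + act q v n.
Proof.
rewrite (act_w _ _ (msuppD_le p q)) (act_w _ _ (fsubsetUl _ (msupp q))).
rewrite (act_w _ _ (fsubsetUr (msupp p) _)) -big_split /=.
by apply: eq_bigr => m _; rewrite mcoeffD mulrDl.
Qed.

Lemma act0 v n : act 0 v n = 0.
Proof. by rewrite /act msupp0 big_seq_fset0. Qed.

Lemma actU c m v n : act << c *g m >> v n = c * act_word m v n.
Proof. by rewrite (act_w _ _ msuppU_le) big_seq_fset1 mcoeffUU. Qed.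

Lemma actN p v n : act (- p) v n = - act p v n.
Proof. by apply/eqP; rewrite -addr_eq0 -actD addNr act0. Qed.

Lemma actM p q v n : act (p * q) v n = act p (act q v) n.
Proof.
have act_sum (I : Type) (r : seq I) (F : I -> free_alg) :
    act (\sum_(i <- r) F i) v n = \sum_(i <- r) act (F i) v n.
  by elim/big_rec2: _ => [|i x y _ <-]; rewrite ?act0 ?actD.
rewrite malgME act_sum; apply: eq_bigr => m1 _.
rewrite act_sum act_word_sum mulr_sumr; apply: eq_bigr => m2 _.
rewrite actU mulrA; congr (_ * _).
by rewrite /mmul /= fmmulE /act_word /= foldr_cat.
Qed.

Lemma act1 v n : act 1 v n = v n.
Proof. by rewrite actU mul1r /mone /= fmoneE. Qed.

Lemma act_genE i v n : act (gen i) v n = act_gen i v n.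
Proof. by rewrite actU mul1r fmuE. Qed.

Lemma act_ideal p v n : p \in leavitt_ideal -> act p v n = 0.
Proof.
move=> /ideal_predP Ip; elim: Ip v n => {p}.
- move=> _ [] v n.
  + rewrite (actD (e_ * e) (- 1)) (actN 1) (act1 v n) (actM e_ e) act_genE /=.
    by rewrite act_genE /= odd_double doubleK subrr.
  + rewrite (actD (f_ * f) (- 1)) (actN 1) (act1 v n) (actM f_ f) act_genE /=.
    by rewrite act_genE /= odd_double uphalf_double subrr.
  + by rewrite (actM e_ f) act_genE /= act_genE /= odd_double.
  + by rewrite (actM f_ e) act_genE /= act_genE /= odd_double.
  + rewrite (actD (e * e_ + f * f_) (- 1)) (actN 1) (act1 v n).
    have Ee : act (e * e_) v n = _ := etrans (actM e e_ v n) (act_genE _ _ _).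
    have Ef : act (f * f_) v n = _ := etrans (actM f f_ v n) (act_genE _ _ _).
    rewrite (etrans (actD _ _ v n) (congr2 +%R Ee Ef)) /= (act_genE (inr false)).
    rewrite (act_genE (inr true)) /= -[in v n](odd_double_half n).
    by case: (odd n); rewrite ?addr0 ?add0r subrr.
- by move=> v n; rewrite act0.
- by move=> x y _ IHx _ IHy v n; rewrite actD IHx IHy addr0.
- move=> a x _ IHx v n; rewrite actM.
  have -> : act x v = fun=> 0 by apply: boolp.funext => k; apply: IHx.
  rewrite /act big1 // => m _.
  have -> : (fun=> 0) = (fun k => \sum_(i <- [::] : seq nat) 0 * v k).
    by apply: boolp.funext => k; rewrite big_nil.
  by rewrite act_word_sum big_nil mulr0.
- by move=> a x _ IHx v n; rewrite actM IHx.
Qed.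

Fact leavitt_one_neq0 : leavitt_one != 0.
Proof.
apply/eqP => e.
have /leavitt_piP : pi 1 = pi 0.
  by rewrite [LHS]e (@pi_zeror _ _ _ _ _ (Quotient.quot leavitt_ideal)).
rewrite subr0 => /(@act_ideal _ (fun=> 1) 0) /eqP.
by rewrite act1 oner_eq0.
Qed.

HB.instance Definition _ := GRing.Zmodule_isNzRing.Build leavitt
  leavitt_mulA leavitt_mul1 leavitt_1mul leavitt_mulDl leavitt_mulDr
  leavitt_one_neq0.

Fact leavitt_scalerA a b x :
  leavitt_scale a (leavitt_scale b x) = leavitt_scale (a * b) x.
Proof. by have [y ->] := leavittW x; rewrite !leavitt_piZ scalerA. Qed.
Fact leavitt_scale1r : left_id 1 leavitt_scale.
Proof. by move=> x; have [y ->] := leavittW x; rewrite leavitt_piZ scale1r. Qed.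
Fact leavitt_scalerDr : right_distributive leavitt_scale +%R.
Proof.
move=> c x y; have [[x' ->] [y' ->]] := (leavittW x, leavittW y).
by rewrite -leavitt_piD !leavitt_piZ scalerDr leavitt_piD.
Qed.
Fact leavitt_scalerDl x : {morph leavitt_scale^~ x : a b / a + b}.
Proof.
move=> a b; have [y ->] := leavittW x.
by rewrite !leavitt_piZ scalerDl leavitt_piD.
Qed.
HB.instance Definition _ := GRing.Zmodule_isLmodule.Build K leavitt
  leavitt_scalerA leavitt_scale1r leavitt_scalerDr leavitt_scalerDl.

Fact leavitt_scalerAl (c : K) (x y : leavitt) : c *: (x * y) = (c *: x) * y.
Proof.
have [[x' ->] [y' ->]] := (leavittW x, leavittW y).
by rewrite [RHS](congr1 (leavitt_mul^~ _) (leavitt_piZ c x')) leavitt_piM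
  [x in _ *: x]leavitt_piM [LHS]leavitt_piZ scalerAl.
Qed.
HB.instance Definition _ :=
  GRing.Lmodule_isLalgebra.Build K leavitt leavitt_scalerAl.

Fact leavitt_scalerAr (c : K) (x y : leavitt) : c *: (x * y) = x * (c *: y).
Proof.
have [[x' ->] [y' ->]] := (leavittW x, leavittW y).
by rewrite [RHS](congr1 (leavitt_mul _) (leavitt_piZ c y')) leavitt_piM
  [x in _ *: x]leavitt_piM [LHS]leavitt_piZ free_alg_scalerAr.
Qed.
HB.instance Definition _ :=
  GRing.Lalgebra_isAlgebra.Build K leavitt leavitt_scalerAr.

Definition leavitt_invertible (x : leavitt) : Prop :=
  exists y, y * x = 1 /\ x * y = 1.
Definition leavitt_unit : pred leavitt :=
  fun x => boolp.asbool (leavitt_invertible x).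
Definition leavitt_inv (x : leavitt) : leavitt :=
  if boolp.pselect (leavitt_invertible x) is left h
  then sval (boolp.cid h) else x.

Fact leavitt_mulVr : {in leavitt_unit, left_inverse 1 leavitt_inv *%R}.
Proof.
move=> x /boolp.asboolP Ux; rewrite /leavitt_inv.
case: boolp.pselect => [h|/(_ Ux) []]; case: boolp.cid => y [Hl Hr].
exact: Hl.
Qed.
Fact leavitt_mulrV : {in leavitt_unit, right_inverse 1 leavitt_inv *%R}.
Proof.
move=> x /boolp.asboolP Ux; rewrite /leavitt_inv.
case: boolp.pselect => [h|/(_ Ux) []]; case: boolp.cid => y [Hl Hr].
exact: Hr.
Qed.
Fact leavitt_unitP x y : y * x = 1 /\ x * y = 1 -> leavitt_unit x.
Proof. by move=> h; apply/boolp.asboolP; exists y. Qed.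
Fact leavitt_inv_out : {in [predC leavitt_unit], leavitt_inv =1 id}.
Proof.
move=> x Ux; rewrite /leavitt_inv; case: boolp.pselect => [h|_]; last exact: erefl.
by case/negP: Ux; apply/boolp.asboolP.
Qed.
HB.instance Definition _ := GRing.NzRing_hasMulInverse.Build leavitt
  leavitt_mulVr leavitt_mulrV leavitt_unitP leavitt_inv_out.

Definition edge (x : letter) : leavitt := pi (gen (inl x)).
Definition ghost (x : letter) : leavitt := pi (gen (inr x)).

Lemma ghost_edge x y : ghost x * edge y = (x == y)%:R.
Proof.
have rel0 p q : leavitt_rels (p * q) -> leavitt_mul (pi p) (pi q) = pi 0.
  move=> Hpq; rewrite leavitt_piM; apply/leavitt_piP; rewrite (subr0 (p * q)).
  exact/ideal_predP/IdealGen.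
have rel1 p q : leavitt_rels (p * q - 1) -> leavitt_mul (pi p) (pi q) = pi 1.
  move=> Hpq; rewrite leavitt_piM; apply/leavitt_piP.
  exact/ideal_predP/IdealGen.
have pi0 : pi 0 = 0 by apply: (@pi_zeror _ _ _ _ _ (Quotient.quot leavitt_ideal)).
case: x; case: y.
- exact: rel1 Rel_ff.
- exact: etrans (rel0 _ _ Rel_fe) pi0.
- exact: etrans (rel0 _ _ Rel_ef) pi0.
- exact: rel1 Rel_ee.
Qed.

Lemma edge_ghost_sum :
  edge false * ghost false + edge true * ghost true = 1.
Proof.
rewrite [_ * ghost false]leavitt_piM [_ * ghost true]leavitt_piM -leavitt_piD.
exact/leavitt_piP/ideal_predP/IdealGen/Rel_1.
Qed.

Definition word_val (w : word) : leavitt := \prod_(x <- w) edge x.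
Definition word_star (w : word) : leavitt := \prod_(x <- rev w) ghost x.
End Leavitt.

Definition full_subtree (T : {fset word}) : Prop :=
  [/\ [::] \in T,
      forall v w, prefix v w -> w \in T -> v \in T
    & forall w, w \in T -> (rcons w false \in T) = (rcons w true \in T)].

Definition leaves (T : {fset word}) : {fset word} :=
  [fset w in T | [forall x, rcons w x \notin T]]%fset.

Definition ordered_leaf_set (s : seq word) : Prop :=
  uniq s /\ exists2 T, full_subtree T & s =i leaves T.

Section LM2.
Variable K : fieldType.

Definition LM_elt n (A : n.-tuple word) (M : 'M[K]_n) (B : n.-tuple word) :
    leavitt K :=
  \sum_i \sum_j M i j *: (word_val K (tnth A i) * word_star K (tnth B j)).

Definition LM2 (x : unitGroup (leavitt K)) : Prop :=
  exists n (A B : n.-tuple word) (M : 'M[K]_n),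
    [/\ (0 < n)%N, ordered_leaf_set A, ordered_leaf_set B, M \in unitmx
      & val x = LM_elt A M B].
End LM2.

(* Main.v *)
(** Along the right comb of the binary tree put [w_i = f^i e].  Then
    [w_i^* w_j = delta_ij], so the products [w_i w_j^*] multiply like matrix
    units and [M |-> 1 + sum_ij (M - 1)_ij w_i w_j^*] is an injective group
    homomorphism on each [GL_n(K)], visibly invariant under
    [M |-> diag(M, 1)].  Since [1 = sum_(i < n) w_i w_i^* + f^n (f^n)^*], the
    image of [M] is [u(A, diag(M, 1), A)], where [A = (w_0, ..., w_(n-1), f^n)]
    is the leaf set of a comb. *)
Require Import Defs.
From mathcomp Require Import all_boot all_algebra.
From HB Require Import structures.
From mathcomp Require Import finmap.

Set Implicit Arguments.
Unset Strict Implicit.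
Unset Printing Implicit Defensive.

Import GRing.Theory.
Local Open Scope ring_scope.

(** * Homomorphisms out of a direct limit of groups *)

Section DirlimLift.
Variables (G : nat -> groupType) (f : forall n, {multiplicative G n -> G n.+1}).
Variables (H : groupType) (phi : forall n, {multiplicative G n -> H}).
Hypothesis phi_f : forall n (x : G n), phi n.+1 (f n x) = phi n x.

Lemma phi_trans n p (le_np : (n <= p)%N) (x : G n) :
  phi p (trans f le_np x) = phi n x.
Proof.
(* On dependent pairs the cast hidden in [trans] disappears and [trans] becomes an iterate of the
   transition maps, so induction on [p - n] applies. *)
pose phis (s : stage G) := phi (tag s) (tagged s).
rewrite -[LHS]/(phis (stage_of (trans f le_np x))) stage_of_trans.
by elim: (p - n)%N => //= k; rewrite /phis /= phi_f.
Qed.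

Definition dirlim_lift (x : dirlim f) : H :=
  phi (tag (repr x)) (tagged (repr x)).

Lemma dirlim_liftE n (x : G n) : dirlim_lift (to_dirlim f x) = phi n x.
Proof.
have [p [len [ler e]]] := repr_to_dirlim f x.
by rewrite /dirlim_lift -(phi_trans ler) e phi_trans.
Qed.

Fact dirlim_liftM : {morph dirlim_lift : x y / (x * y)%g >-> (x * y)%g}.
Proof.
move=> x y; have [n [x' [y' [-> ->]]]] := dirlimW2 x y.
by rewrite -to_dirlimM !dirlim_liftE gmulfM.
Qed.

Definition dirlim_morphism : {multiplicative dirlim f -> H} :=
  HB.pack dirlim_lift
    (monoid.isMultiplicative.Build (dirlim f) H dirlim_lift dirlim_liftM).

(** Two elements of the limit always come from a common stage, so injectivity can be tested
    there. *)
Lemma dirlim_lift_inj :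
  (forall n, injective (phi n)) -> injective dirlim_lift.
Proof.
move=> phi_inj x y; have [n [x' [y' [-> ->]]]] := dirlimW2 x y.
by rewrite !dirlim_liftE => /phi_inj ->.
Qed.
End DirlimLift.

(** * Entries of the matrix diag(M, 1) *)

Section Diag1.
Variables (K : fieldType) (n : nat).
Implicit Type M : 'M[K]_n.

Let widen := widen_ord (leqnSn n).

Lemma diag1_widen M i j : diag1 M (widen i) (widen j) = M i j.
Proof.
rewrite /diag1 castmxE.
have wE (k : 'I_n) : cast_ord (esym (addn1 n)) (widen k) = lshift 1 k.
  exact: val_inj.
by rewrite !wE block_mxEul.
Qed.

Lemma diag1_widen_max M i : diag1 M (widen i) ord_max = 0.
Proof.
rewrite /diag1 castmxE.
have -> : cast_ord (esym (addn1 n)) (widen i) = lshift 1 i by exact: val_inj.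
have -> : cast_ord (esym (addn1 n)) ord_max = rshift n 0.
  by apply: val_inj; rewrite /= addn0.
by rewrite block_mxEur mxE.
Qed.

Lemma diag1_max_widen M j : diag1 M ord_max (widen j) = 0.
Proof.
rewrite /diag1 castmxE.
have -> : cast_ord (esym (addn1 n)) (widen j) = lshift 1 j by exact: val_inj.
have -> : cast_ord (esym (addn1 n)) ord_max = rshift n 0.
  by apply: val_inj; rewrite /= addn0.
by rewrite block_mxEdl mxE.
Qed.

Lemma diag1_max_max M : diag1 M ord_max ord_max = 1.
Proof.
rewrite /diag1 castmxE.
have -> : cast_ord (esym (addn1 n)) ord_max = rshift n 0.
  by apply: val_inj; rewrite /= addn0.
by rewrite block_mxEdr mxE.
Qed.

Lemma diag1_1 : diag1 (1%:M : 'M[K]_n) = 1%:M.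
Proof.
by rewrite /diag1 -scalar_mx_block; case: _ / (addn1 n) => //.
Qed.
End Diag1.

(** * Matrix units in an algebra and the induced maps on GL_n *)

Section MatrixUnits.
Variables (K : fieldType) (R : unitAlgType K).

(** The families are indexed by [nat] so that the same ones serve every size [n]. *)
Definition mx_sum (a b : nat -> R) n (M : 'M[K]_n) : R :=
  \sum_i \sum_j M i j *: (a i * b j).

Lemma eq_mx_sum a b a' b' n (M : 'M[K]_n) :
  (forall i, (i < n)%N -> a i = a' i) -> (forall i, (i < n)%N -> b i = b' i) ->
  mx_sum a b M = mx_sum a' b' M.
Proof.
move=> aE bE; apply: eq_bigr => i _; apply: eq_bigr => j _.
by rewrite aE ?bE.
Qed.

Lemma mx_sum_diag1 a b n (M : 'M[K]_n) :
  mx_sum a b (diag1 M) = mx_sum a b M + a n * b n.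
Proof.
rewrite /mx_sum big_ord_recr /= big_ord_recr /= diag1_max_max scale1r.
rewrite [X in _ + (X + _)]big1 ?add0r => [|j _]; last first.
  by rewrite diag1_max_widen scale0r.
congr (_ + _); apply: eq_bigr => i _.
rewrite big_ord_recr /= diag1_widen_max scale0r addr0.
by apply: eq_bigr => j _; rewrite diag1_widen.
Qed.

Lemma mx_sumB a b n : {morph @mx_sum a b n : M N / M - N}.
Proof.
move=> M N; rewrite /mx_sum -sumrB; apply: eq_bigr => i _.
by rewrite -sumrB; apply: eq_bigr => j _; rewrite !mxE scalerBl.
Qed.

Variables a b : nat -> R.
Hypothesis ba : forall i j, b i * a j = (i == j)%:R.

(** By [ba], [M] acts on the [a i] as on a basis; products and injectivity both reduce to this. *)
Lemma mul_mx_sum_a n (M : 'M[K]_n) (j : 'I_n) :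
  mx_sum a b M * a j = \sum_i M i j *: a i.
Proof.
rewrite mulr_suml; apply: eq_bigr => i _.
rewrite mulr_suml (bigD1 j) //= big1 ?addr0 => [|k /negPf kj].
  by rewrite -scalerAl -mulrA ba eqxx mulr1.
by rewrite -scalerAl -mulrA ba [(_ == _ :> nat)]kj mulr0 scaler0.
Qed.

Lemma mx_sumM n (M N : 'M[K]_n) :
  mx_sum a b M * mx_sum a b N = mx_sum a b (M *m N).
Proof.
transitivity (\sum_k \sum_j \sum_i (M i k * N k j) *: (a i * b j)).
  rewrite [mx_sum a b N]/mx_sum mulr_sumr; apply: eq_bigr => k _.
  rewrite mulr_sumr; apply: eq_bigr => j _.
  rewrite -scalerAr mulrA mul_mx_sum_a mulr_suml scaler_sumr.
  by apply: eq_bigr => i _; rewrite -scalerAl scalerA mulrC.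
rewrite exchange_big /= [RHS]exchange_big /=; apply: eq_bigr => j _.
rewrite exchange_big /=; apply: eq_bigr => i _.
by rewrite mxE scaler_suml.
Qed.

(** Multiplying by [b i] on the left and [a j] on the right isolates the entry [M i j] as a multiple
    of 1, and 1 is nonzero in [R]. *)
Lemma mx_sum_inj n : injective (@mx_sum a b n).
Proof.
move=> M N eMN; apply/matrixP => i j; apply/eqP.
have coefE (P : 'M[K]_n) : b i * (mx_sum a b P * a j) = (P i j)%:A.
  rewrite mul_mx_sum_a mulr_sumr (bigD1 i) //= big1 ?addr0 => [|k ki].
    by rewrite -scalerAr ba eqxx.
  rewrite -scalerAr ba; have -> : (i == k :> nat) = false by rewrite eq_sym; apply: negPf.
  by rewrite scaler0.
have: (M i j)%:A = (N i j)%:A :> R by rewrite -!coefE eMN.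
by move/eqP; rewrite -subr_eq0 -scalerBl scaler_eq0 oner_eq0 orbF subr_eq0.
Qed.

(** The image of the identity under [mx_sum] is only an idempotent; adding its complement makes the
    map unital. *)
Definition mx_unital n (M : 'M[K]_n) : R := 1 + mx_sum a b (M - 1%:M).

Lemma mx_unital_diag1 n (M : 'M[K]_n) : mx_unital (diag1 M) = mx_unital M.
Proof.
by rewrite /mx_unital -diag1_1 !mx_sumB !mx_sum_diag1 opprD addrACA subrr addr0.
Qed.

Lemma mx_unital1 n : mx_unital (1%:M : 'M[K]_n) = 1.
Proof. by rewrite /mx_unital mx_sumB subrr addr0. Qed.

Lemma mx_unitalM n (M N : 'M[K]_n) :
  mx_unital (M *m N) = mx_unital M * mx_unital N.
Proof.
rewrite /mx_unital mulrDl mul1r mulrDr mulr1 -addrA; congr (1 + _).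
(* With S for [mx_sum a b], the product of the two corrections is S(MN) - S(M) - S(N) + S(1), which
   cancels the linear terms down to S(MN) - S(1). *)
rewrite !mx_sumB mulrBl !mulrBr !mx_sumM !(mulmx1, mul1mx).
by rewrite [RHS]addrC [X in _ = X + _]addrA subrK [RHS]addrC subrKA.
Qed.

Lemma mx_unital_inj n : injective (@mx_unital n).
Proof. by move=> M N /addrI/mx_sum_inj/addIr. Qed.

Fact mx_unital_unit n (M : GL K n) : mx_unital (val M) \is a GRing.unit.
Proof.
apply/unitrP; exists (mx_unital (val M)^-1).
by rewrite -!mx_unitalM !mulmxE mulVr ?mulrV ?mx_unital1 ?(valP M).
Qed.

Definition GL_emb n (M : GL K n) : unitGroup R := UnitGroup (mx_unital_unit M).

Fact GL_embM n : {morph @GL_emb n : M N / (M * N)%g >-> (M * N)%g}.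
Proof. by move=> M N; apply: val_inj; apply: mx_unitalM. Qed.
HB.instance Definition _ n :=
  monoid.isMultiplicative.Build (GL K n) (unitGroup R) (@GL_emb n) (@GL_embM n).

Lemma GL_emb_incl n (M : GL K n) : GL_emb (GL_incl M) = GL_emb M.
Proof. by apply: val_inj; apply: mx_unital_diag1. Qed.

Lemma GL_emb_inj n : injective (@GL_emb n).
Proof. by move=> M N [/mx_unital_inj/val_inj]. Qed.

(** Here [c] is the complementary idempotent; the right-hand side has the shape of the sum attached
    to diag(M, 1). *)
Lemma mx_unital_complete n (M : 'M[K]_n) c :
  mx_sum a b (1%:M : 'M_n) + c = 1 -> mx_unital M = mx_sum a b M + c.
Proof.
by move=> h; rewrite /mx_unital mx_sumB -h addrC addrA subrK.
Qed.
End MatrixUnits.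

(** Inserting the relation between [v] and [s] is the algebraic form of a simple expansion of a
    leaf. *)
Lemma sandwich (R : pzRingType) (v e0 g0 e1 g1 s : R) :
  e0 * g0 + e1 * g1 = 1 -> v * e0 * (g0 * s) + v * e1 * (g1 * s) = v * s.
Proof.
move=> h; rewrite -!mulrA -mulrDr !mulrA -[in RHS](mulr1 v) -h.
by rewrite !mulrDr mulrDl !mulrA.
Qed.

(** * Comb words in the Leavitt algebra *)

Section Comb.
Variable K : fieldType.
Local Notation val_ := (word_val K).
Local Notation star := (word_star K).

Definition comb_leaf i : word := rcons (nseq i true) false.

Lemma word_val_cons x w : val_ (x :: w) = edge K x * val_ w.
Proof. exact: big_cons. Qed.

Lemma word_star_cons x w : star (x :: w) = star w * ghost K x.
Proof. by rewrite /word_star rev_cons -cats1 big_cat big_seq1. Qed.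

Lemma word_val_rcons w x : val_ (rcons w x) = val_ w * edge K x.
Proof. by rewrite /word_val -cats1 big_cat big_seq1. Qed.

Lemma word_star_rcons w x : star (rcons w x) = ghost K x * star w.
Proof. by rewrite /word_star rev_rcons big_cons. Qed.

Lemma star_val_cons x v y w :
  star (x :: v) * val_ (y :: w) = (x == y)%:R * (star v * val_ w).
Proof.
rewrite word_star_cons word_val_cons mulrA -[X in X * _]mulrA ghost_edge.
by rewrite mulr_natr mulr_natl mulrnAl.
Qed.

(** Common leading letters [f] cancel until one word is reduced to [e]; the other is then also [e],
    or begins with [f] and gives 0. *)
Lemma star_val_comb_leaf i j :
  star (comb_leaf i) * val_ (comb_leaf j) = (i == j)%:R.
Proof.
elim: i j => [|i IHi] [|j]; rewrite star_val_cons mulr_natl ?mulr0n //.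
  by rewrite /word_star /word_val !big_nil mulr1.
by rewrite IHi.
Qed.

(** Each induction step expands the last leaf f^n into f^n e and f^n f. *)
Lemma comb_complete n :
  mx_sum (val_ \o comb_leaf) (star \o comb_leaf) (1%:M : 'M[K]_n)
    + val_ (nseq n true) * star (nseq n true) = 1.
Proof.
elim: n => [|n IHn].
  by rewrite /mx_sum big_ord0 add0r /word_val /word_star !big_nil mulr1.
rewrite -diag1_1 mx_sum_diag1 -[RHS]IHn -addrA; congr (_ + _).
have -> : nseq n.+1 true = rcons (nseq n true) true.
  by rewrite -cats1 -(nseqD n 1) addn1.
by rewrite /= !word_val_rcons !word_star_rcons (sandwich _ _ (edge_ghost_sum K)).
Qed.

(** The leaf f^n comes last, to meet the corner entry 1 of [diag1 M]. *)
Definition comb n : seq word := rcons (mkseq comb_leaf n) (nseq n true).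

Lemma size_comb n : size (comb n) == n.+1.
Proof. by rewrite size_rcons size_mkseq. Qed.
Definition comb_tuple n : n.+1.-tuple word := Tuple (size_comb n).

Lemma LM_elt_comb n (M : 'M[K]_n) :
  LM_elt (comb_tuple n) (diag1 M) (comb_tuple n) =
  mx_sum (val_ \o comb_leaf) (star \o comb_leaf) M
    + val_ (nseq n true) * star (nseq n true).
Proof.
pose a i := val_ (nth [::] (comb n) i); pose b i := star (nth [::] (comb n) i).
transitivity (mx_sum a b (diag1 M)).
  by apply: eq_bigr => i _; apply: eq_bigr => j _; rewrite !(tnth_nth [::]).
have nthE i : (i < n)%N -> nth [::] (comb n) i = comb_leaf i.
  by move=> lt_in; rewrite nth_rcons size_mkseq lt_in nth_mkseq.
have nthn : nth [::] (comb n) n = nseq n true.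
  by rewrite nth_rcons size_mkseq ltnn eqxx.
rewrite mx_sum_diag1 /a /b nthn.
by rewrite (eq_mx_sum (a' := val_ \o comb_leaf) (b' := star \o comb_leaf))
  // => i lt_in /=; rewrite nthE.
Qed.
End Comb.

(** * Combs as leaf sets of full subtrees *)

Section CombLeaves.
Local Open Scope fset_scope.

(** A new root with leaf [e] on one side and [T] hung below [f]. Growing combs at the root reduces
    membership to a case on the first letter. *)
Definition graft (T : {fset word}) : {fset word} :=
  [fset w in [::] :: [:: false] :: map (cons true) T].

Lemma in_graft T w : (w \in graft T) =
  match w with
  | [::] => true
  | false :: v => v == [::]
  | true :: v => v \in T
  end.
Proof.
rewrite !inE; case: w => [|[] v] //=.
  by rewrite mem_map //; apply: (can_inj (g := behead)).
rewrite eqseq_cons eqxx /=; case: eqP => //= _.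
by apply/mapP => -[].
Qed.

Lemma full_subtree_graft T : full_subtree T -> full_subtree (graft T).
Proof.
case=> T0 Tpre Tfull; split=> [|v w|w]; first by rewrite in_graft.
  rewrite !in_graft; case: v => [|[] v] //; case: w => [|[] w] //=.
    exact: Tpre.
  by move=> vw /eqP w0; move: vw; rewrite w0; case: v.
rewrite !in_graft; case: w => [|[] w] //=; first exact: Tfull.
by case: w.
Qed.

Lemma in_leaves T w :
  (w \in leaves T) = (w \in T) && [forall x, rcons w x \notin T].
Proof. by rewrite !inE. Qed.

Lemma leaves_graft T : full_subtree T ->
  leaves (graft T) =i [:: false] :: map (cons true) (leaves T).
Proof.
case=> T0 _ _ w; rewrite in_leaves in_cons in_graft.
have injT : injective (cons true) by apply: (can_inj (g := behead)).
case: w => [|[] w].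
- have -> : [forall x, rcons [::] x \notin graft T] = false.
    (* The new root is no leaf: its child [f] is the root of [T]. *)
    by apply/forallP => /(_ true); rewrite in_graft => /negP[].
  by apply/esym/mapP => -[].
- rewrite eqseq_cons /= mem_map // in_leaves; congr (_ && _).
  by apply: eq_forallb => x; rewrite in_graft.
rewrite eqseq_cons eqxx /=.
have -> : false :: w \in [seq true :: i | i <- leaves T] = false.
  by apply/mapP => -[].
rewrite orbF; case: eqP => //= ->.
by apply/forallP => x; rewrite in_graft.
Qed.

Lemma ordered_leaf_set_graft s :
  ordered_leaf_set s -> ordered_leaf_set ([:: false] :: map (cons true) s).
Proof.
case=> s_uniq [T fullT sT]; split.
  rewrite /= map_inj_uniq ?s_uniq ?andbT; last exact: (can_inj (g := behead)).
  by apply/mapP => -[].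
exists (graft T); first exact: full_subtree_graft.
move=> w; rewrite leaves_graft // !inE; congr (_ || _).
by apply/mapP/mapP => -[v sv ->]; exists v; rewrite // ?sT // -sT.
Qed.

Lemma ordered_leaf_set_comb n : ordered_leaf_set (comb n).
Proof.
elim: n => [|n IHn].
  split=> //; exists [fset [::]].
    split=> [|v w|w]; rewrite ?inE //; last by case: w.
    by move=> vw /eqP w0; move: vw; rewrite w0; case: v.
  move=> w; rewrite !inE; case: eqP => //= ->.
  by apply/esym/forallP => x; rewrite inE.
(* Apart from the first tooth [e], every leaf of the longer comb is [f] followed by a leaf of the
   shorter one. *)
have -> : comb n.+1 = [:: false] :: map (cons true) (comb n).
  by rewrite /comb map_rcons /mkseq -map_comp -[iota 0 n.+1]/(0 :: iota 1 n)
             (iotaDl 1 0) -/(map _ _) /= -map_comp.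
exact: ordered_leaf_set_graft.
Qed.
End CombLeaves.

Theorem proposition6p2 (K : fieldType) :
  exists Phi : {multiplicative GLinf K -> unitGroup (leavitt K)},
    injective Phi /\ forall g : GLinf K, LM2 (Phi g).
Proof.
have ba := star_val_comb_leaf K.
pose phi n : {multiplicative GL K n -> unitGroup (leavitt K)} :=
  @GL_emb K (leavitt K) _ _ ba n.
pose incl n : {multiplicative GL K n -> GL K n.+1} := @GL_incl K n.
have phi_incl n (M : GL K n) : phi n.+1 (incl n M) = phi n M.
  exact: GL_emb_incl.
exists (dirlim_morphism phi_incl); split.
  by apply: dirlim_lift_inj phi_incl _ => n; apply: GL_emb_inj.
move=> g; have [n [M ->]] := dirlimW g.
rewrite [dirlim_morphism _ _](dirlim_liftE phi_incl).
(* [GL K n] consists of matrices of size n+1, and a comb with n+1 teeth has n+2 leaves. *)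
exists n.+2, (comb_tuple n.+1), (comb_tuple n.+1), (diag1 (val M)).
split=> //; try exact: ordered_leaf_set_comb.
  by rewrite diag1_unit; apply: (valP M).
by rewrite LM_elt_comb; apply/mx_unital_complete/comb_complete.
Qed.
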